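(* Let $d\ge n\ge 1$, and let $\mathbf{Q}(\xi)=(\xi_{\lambda_{2m-1}}\xi_{\lambda_{2m}})_{m=1}^n$, with $\lambda_1,\dots,\lambda_{2n}\in\{1,\dots,d\}$, be an $n$-tuple of quadratic monomials on $\mathbb{R}^d$. Suppose that $J_{\mathbf{Q}}(\xi;i_1,\dots,i_{d-n})\not\equiv 0$ for some $i_1,\dots,i_{d-n}$. Then $$J_{\mathbf{Q}}(\xi;i_1,\dots,i_{d-n})=c\prod_{j=1}^d\xi_j^{s_j}$$ for some real $c\ne 0$ and some nonnegative integers $s_1,\dots,s_d$ with $\sum_{j=1}^d s_j=n$. Moreover, for $1\le j\le d$ let $w_j$ be the number of indices $i\in\{1,\dots,2n\}$ with $\lambda_i=j$. Then $\max_j s_j\le\max_j w_j$. If in addition $\max_j w_j\ne 1$, then there exist $i_1',\dots,i_{d-n}'$ such that $$J_{\mathbf{Q}}(\xi;i_1',\dots,i_{d-n}')=c'\prod_{j=1}^d\xi_j^{s_j'}\not\equiv 0$$ for some real $c'\ne0$ and nonnegative integers $s_1',\dots,s_d'$ with $\sum_{j=1}^d s_j'=n$, and $$\max_j s_j'\le \max_j w_j-1.$$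
   Context: A tuple of quadratic forms ''on $\mathbb{R}^d$'' is assumed to depend on exactly $d$ variables, i.e. each of $\xi_1,\dots,\xi_d$ actually occurs in it. Generalized Jacobian: for an $n$-tuple $\mathbf{Q}=(Q_1,\dots,Q_n)$ of real quadratic forms on $\mathbb{R}^d$ with $d\ge n$ and indices $i_1,\dots,i_{d-n}\in\{1,\dots,d\}$, $J_{\mathbf{Q}}(\xi;i_1,\dots,i_{d-n})$ is the determinant of the $d\times d$ matrix whose first $n$ rows are the rows of $\nabla\mathbf{Q}(\xi)=(\partial_jQ_i(\xi))_{1\le i\le n,\,1\le j\le d}$ and whose remaining $d-n$ rows are $e_{i_1},\dots,e_{i_{d-n}}$, where $e_j$ is the $j$-th unit coordinate vector in $\mathbb{R}^d$. If $d=n$, there are no parameters and $J_{\mathbf{Q}}(\xi)=\det\nabla\mathbf{Q}(\xi)$. *)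

(* Defs.v *)
From mathcomp Require Import all_boot all_order all_algebra.
From mathcomp Require Import reals.
From mathcomp Require Import mpoly.

Set Implicit Arguments.
Unset Strict Implicit.
Unset Printing Implicit Defensive.

Import GRing.Theory.
Local Open Scope ring_scope.

(* Polynomials in [d] variables stand for the polynomial functions on R^d
   they induce: identities and non-vanishing are those of polynomials, which
   over the reals agree with those of functions. *)

Definition all_vars_occur (R : realType) (n d : nat)
    (Q : 'I_n -> {mpoly R[d]}) : Prop :=
  forall j : 'I_d,
    exists m : 'I_n, exists2 u : 'X_{1..d}, u \in msupp (Q m) & u j != 0%N.

Definition gradmx (R : realType) (n d : nat) (Q : 'I_n -> {mpoly R[d]}) :
    'M[{mpoly R[d]}]_(n, d) :=
  \matrix_(m < n, j < d) (Q m)^`M(j).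

(* The cast only identifies n + (d - n) with d. *)
Definition gen_jacobian (R : realType) (n d : nat) (le_nd : (n <= d)%N)
    (Q : 'I_n -> {mpoly R[d]}) (i : 'I_(d - n) -> 'I_d) : {mpoly R[d]} :=
  \det (castmx (subnKC le_nd, erefl d)
          (col_mx (gradmx Q) (\matrix_(k < d - n) delta_mx 0 (i k)))).

Fact pair_fst_subproof (n : nat) (m : 'I_n) : (2 * m < 2 * n)%N.
Proof. by rewrite ltn_pmul2l. Qed.

Fact pair_snd_subproof (n : nat) (m : 'I_n) : ((2 * m).+1 < 2 * n)%N.
Proof. by rewrite !mul2n -doubleS leq_double. Qed.

(* With indices counted from 0, the m-th pair is (2m, 2m + 1). *)
Definition pair_fst (n : nat) (m : 'I_n) : 'I_(2 * n) :=
  Ordinal (pair_fst_subproof m).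

Definition pair_snd (n : nat) (m : 'I_n) : 'I_(2 * n) :=
  Ordinal (pair_snd_subproof m).

Definition monomial_tuple (R : realType) (n d : nat)
    (lam : 'I_(2 * n) -> 'I_d) (m : 'I_n) : {mpoly R[d]} :=
  'X_(lam (pair_fst m)) * 'X_(lam (pair_snd m)).

Definition multiplicity (n d : nat) (lam : 'I_(2 * n) -> 'I_d) (j : 'I_d) :
    nat :=
  #|[set i : 'I_(2 * n) | lam i == j]|.

(* Main.v *)
Require Import Defs.
From mathcomp Require Import all_boot all_order all_algebra.
From mathcomp Require Import perm.
From mathcomp Require Import reals.
From mathcomp Require Import mpoly.

Set Implicit Arguments.
Unset Strict Implicit.
Unset Printing Implicit Defensive.

Import GRing.Theory.
Local Open Scope ring_scope.

(* Read the monomials as the edges of a multigraph on the variables, loops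
   allowed, the m-th edge joining a m and b m.  Multiplying the j-th column of
   the matrix defining J by xi_j turns its rows into the rows of the incidence
   matrix A of the graph, completed by the unit rows, each times a monomial.
   Hence J is det A times the monomial with exponents s_j = w_j + v_j - 1,
   where v_j <= 1 counts the unit rows e_j.

   It remains to move the unit rows away from the vertices of maximal degree
   W >= 2.  Suppose that a unit row e_v with w_v = W cannot be exchanged for
   any e_u with w_u < W while keeping det A nonzero.  Then the cofactors x_u
   of its row are supported on a set U of vertices of degree W, and
   x_a + x_b = 0 on every edge, so an edge meeting U lies in U: there are
   W #|U| / 2 >= #|U| of those.  Together with e_v they are #|U| + 1 rows
   of A supported in #|U| columns, which is absurd. *)

(** A nonzero determinant has a nonzero Leibniz term, hence a permutation [s] along which no entry
    vanishes; [s] then maps [S] injectively into [U]. *)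
Lemma card_supported_rows (K : idomainType) (N : nat) (A : 'M[K]_N)
    (S U : {set 'I_N}) :
  \det A != 0 -> (forall i j, i \in S -> j \notin U -> A i j = 0) ->
  (#|S| <= #|U|)%N.
Proof.
move=> detA suppA.
have [s As_neq0] : exists s : 'S_N, forall i, A i (s i) != 0.
  have [/existsP[s /forallP] | /existsPn no_s] :=
    boolP [exists s : 'S_N, [forall i, A i (s i) != 0]]; first by exists s.
  case/eqP: detA; rewrite /determinant big1 // => s _.
  have /forallPn[i] := no_s s; rewrite negbK => /eqP Ais.
  by rewrite (bigD1 i) //= Ais mul0r mulr0.
rewrite -(card_imset S (@perm_inj _ s)); apply/subset_leq_card/subsetP=> j.
case/imsetP=> i iS ->; apply: contraNT (As_neq0 i) => sU.
by rewrite (suppA _ _ iS sU).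
Qed.

(** * Incidence matrices and exchange of unit rows *)

Section Incidence.
Variables (n p : nat) (a b : 'I_n -> 'I_(n + p)).
Implicit Types (i : 'I_p -> 'I_(n + p)) (j : 'I_(n + p)) (k : 'I_p).

Definition degree j : nat := (\sum_m ((a m == j) + (b m == j)))%N.

Definition incidence_mx (K : nzRingType) i : 'M[K]_(n + p) :=
  col_mx (\matrix_(m, j) ((a m == j) + (b m == j))%:R)
         (\matrix_(k, j) (i k == j)%:R).

Definition upd i k (u : 'I_(n + p)) l := if l == k then u else i l.

Lemma incidence_mx_inj (K : comNzRingType) i :
  \det (incidence_mx K i) != 0 -> injective i.
Proof.
move=> detA k l eq_i; apply/eqP; apply: contraNT detA => neq_kl.
rewrite (@determinant_alternate _ _ _ (rshift n k) (rshift n l)) //.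
  by rewrite eq_rshift.
by move=> j; rewrite !col_mxEd !mxE eq_i.
Qed.

Lemma sum_degree (U : {set 'I_(n + p)}) :
  (\sum_(j in U) degree j = \sum_m ((a m \in U) + (b m \in U)))%N.
Proof.
have sum_ind (v : 'I_(n + p)) : (\sum_(j in U) (v == j) = (v \in U))%N.
  rewrite big_mkcond (bigD1 v) //= eqxx big1 ?addn0; first by case: ifP.
  by move=> j /negPf neq_jv; rewrite [v == j]eq_sym neq_jv; case: ifP.
rewrite exchange_big; apply: eq_bigr => m _.
by rewrite big_split /= !sum_ind.
Qed.

(** In the expansion along the new row only the entry at [u] survives, and its cofactor does not see
    which row was replaced. *)
Lemma det_upd (K : comNzRingType) i k u :
  \det (incidence_mx K (upd i k u)) = cofactor (incidence_mx K i) (rshift n k) u.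
Proof.
rewrite (expand_det_row _ (rshift n k)) (bigD1 u) //= big1 ?addr0 => [|j neq_ju].
  rewrite col_mxEd mxE /upd !eqxx mul1r /cofactor; congr (_ * \det _).
  apply/matrixP=> r j; rewrite !mxE; case: split_ordP => x def_x; rewrite !mxE //.
  rewrite /upd; case: (x =P k) => // def_k; have /eqP[] := neq_lift (rshift n k) r.
  by rewrite def_x def_k.
by rewrite col_mxEd mxE /upd eqxx eq_sym (negPf neq_ju) mul0r.
Qed.

Lemma exchange_unit_row (K : idomainType) i k :
    \det (incidence_mx K i) != 0 -> (1 < degree (i k))%N ->
    (forall j, degree j <= degree (i k))%N ->
  exists2 u, (degree u < degree (i k))%N & \det (incidence_mx K (upd i k u)) != 0.
Proof.
set A := incidence_mx K i; set W := degree (i k) => detA W_gt1 leW.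
pose x u := cofactor A (rshift n k) u.
have [/existsP[u /andP[ltW xu]] | no_u] :=
  boolP [exists u, (degree u < W)%N && (x u != 0)].
  by exists u => //; rewrite det_upd.
have degU u : x u != 0 -> degree u = W.
  move=> xu; apply/eqP; rewrite eqn_leq leW leqNgt.
  by apply: contra no_u => ltW; apply/existsP; exists u; rewrite ltW.
(* [x] is a column of the adjugate, so every row of [A] except the unit row [k] is orthogonal to
   it. *)
have Ax r : \sum_j A r j * x j = \det A *+ (r == rshift n k).
  have /matrixP/(_ r (rshift n k)) := mul_mx_adj A.
  rewrite [LHS]mxE [RHS]mxE => <-; apply: eq_bigr => j _.
  by rewrite [(\adj A) _ _]mxE.
have sum_delta v : \sum_j (v == j)%:R * x j = x v.
  rewrite (bigD1 v) //= eqxx mul1r big1 ?addr0 // => j /negPf.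
  by rewrite eq_sym => ->; rewrite mul0r.
have x_edge m : x (a m) + x (b m) = 0.
  have := Ax (lshift p m); rewrite eq_lrshift mulr0n => <-.
  rewrite -(sum_delta (a m)) -(sum_delta (b m)) -big_split /=.
  by apply: eq_bigr => j _; rewrite col_mxEu mxE natrD mulrDl.
have x_ik : x (i k) = \det A.
  have := Ax (rshift n k); rewrite eqxx mulr1n => <-; rewrite -(sum_delta (i k)).
  by apply: eq_bigr => j _; rewrite col_mxEd mxE.
pose U := [set u | x u != 0].
have abU m : (b m \in U) = (a m \in U).
  by rewrite !inE; move/eqP: (x_edge m); rewrite addr_eq0 => /eqP->; rewrite oppr_eq0.
pose E := [set m | a m \in U].
pose S := rshift n k |: [set lshift p m | m in E].
have leSU : (#|S| <= #|U|)%N.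
  apply: (card_supported_rows (A := A)) => // r j /setU1P[-> jU | /imsetP[m mE ->] jU].
    rewrite col_mxEd mxE; case: eqP => // def_j.
    by case/negP: jU; rewrite -def_j inE x_ik.
  have aU : a m \in U by move: mE; rewrite inE.
  have neq_j v : v \in U -> (v == j) = false.
    by move=> vU; apply: contraNF jU => /eqP <-.
  by rewrite col_mxEu mxE !neq_j ?abU.
have cardS : #|S| = #|E|.+1.
  rewrite cardsU1 card_imset; last exact: lshift_inj.
  by rewrite (_ : _ \notin _) //; apply/imsetP=> -[m _ /eqP]; rewrite eq_rlshift.
(* Double counting of the edge ends in [U]: by [abU] an edge has both ends in [U] or none, and a
   loop counts twice. *)
have degsum : (#|U| * W = #|E| * 2)%N.
  rewrite -!sum_nat_const; transitivity (\sum_(u in U) degree u)%N.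
    by apply: eq_bigr => u; rewrite inE => /degU.
  rewrite sum_degree [RHS]big_mkcond; apply: eq_bigr => m _.
  by rewrite abU [m \in E]inE; case: (a m \in U).
have: (#|U| * 2 <= #|E| * 2)%N by rewrite -degsum leq_mul2l W_gt1 orbT.
by rewrite leq_pmul2r // leqNgt -cardS leSU.
Qed.

(** Induction on the number of unit rows at vertices of degree [W]: each exchange removes one and,
    since [u] has smaller degree, creates none. *)
Lemma unit_rows_off_max_degree (K : idomainType) i W :
    (1 < W)%N -> (forall j, degree j <= W)%N -> \det (incidence_mx K i) != 0 ->
  exists2 i', \det (incidence_mx K i') != 0 & forall k, (degree (i' k) < W)%N.
Proof.
move=> W_gt1 leW.
have [N] := ubnP #|[set k | degree (i k) == W]|.
elim: N i => // N IHN i; rewrite ltnS => leN detA.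
have [all_lt | /forallPn[k]] := boolP [forall k, (degree (i k) < W)%N].
  by exists i => // k; apply: (forallP all_lt).
rewrite -leqNgt => geW; have def_W : degree (i k) = W.
  by apply/eqP; rewrite eqn_leq leW.
have [||u] := @exchange_unit_row K i k detA; rewrite def_W // => ltW det_u.
apply: (IHN _ _ det_u); apply: leq_trans leN; apply: proper_card; apply/properP; split.
  apply/subsetP=> l; rewrite !inE /upd; case: (l =P k) => // ->.
  by rewrite def_W.
by exists k; rewrite !inE /upd ?def_W ?eqxx // (ltn_eqF ltW).
Qed.

End Incidence.

Lemma prod_expr_fiber (K : comNzRingType) (I J : finType) (f : I -> J)
    (x : J -> K) :
  \prod_m x (f m) = \prod_j x j ^+ (\sum_m (f m == j))%N.
Proof.
under [RHS]eq_bigr => j _ do rewrite expr_sum.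
rewrite exchange_big; apply: eq_bigr => m _; rewrite (bigD1 (f m)) //= eqxx.
rewrite big1 ?mulr1 // => j /negPf; rewrite eq_sym => ->.
by rewrite expr0.
Qed.

Lemma mderiv_var (K : nzRingType) (N : nat) (u v : 'I_N) :
  ('X_u : {mpoly K[N]})^`M(v) = (u == v)%:R.
Proof.
rewrite mderivX mnm1E; case: eqP => [-> | _]; last by rewrite scale0r.
by rewrite -[X in (X - _)%MM]add0m addmK mpolyX0 scale1r.
Qed.

(** * From the Jacobian to the incidence matrix *)

Section Jacobian.
Variables (R : realType) (n p : nat) (lam : 'I_(2 * n) -> 'I_(n + p)).
Implicit Types (i : 'I_p -> 'I_(n + p)) (j : 'I_(n + p)).

Let a m := lam (pair_fst m).
Let b m := lam (pair_snd m).

Definition jacobian i : {mpoly R[n + p]} :=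
  \det (col_mx (gradmx (monomial_tuple R lam)) (\matrix_k delta_mx 0 (i k))).

Lemma multiplicityE j : multiplicity lam j = degree a b j.
Proof.
rewrite /multiplicity -sum1dep_card big_mkcond /=.
(* Splitting the indices by parity; injectivity and equal cardinalities make [pr] a bijection. *)
pose pr (mb : 'I_n * bool) := if mb.2 then pair_snd mb.1 else pair_fst mb.1.
have pr_inj : injective pr.
  move=> [m []] [m' []] /(congr1 val) /=; last first.
  - by move=> /eqP; rewrite eqn_mul2l /= => /eqP/val_inj->.
  - by move/(congr1 odd); rewrite /= !mul2n !odd_double.
  - by move/(congr1 odd); rewrite /= !mul2n !odd_double.
  by move=> [] /eqP; rewrite eqn_mul2l /= => /eqP/val_inj->.
rewrite (reindex pr); last first.
  apply: onW_bij; apply: inj_card_bij pr_inj _.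
  by rewrite card_prod !card_ord card_bool mulnC.
rewrite -(pair_bigA _ (fun m c => if lam (pr (m, c)) == j then 1 else 0)%N) /=.
apply: eq_bigr => m _; rewrite big_bool /= addnC /a /b.
by do 2 case: eqP.
Qed.

Lemma degree_gt0 j : all_vars_occur (monomial_tuple R lam) -> (0 < degree a b j)%N.
Proof.
move=> /(_ j)[m [u]]; rewrite /monomial_tuple -mpolyXD msuppX inE => /eqP->.
rewrite mnmDE !mnm1E => occ; rewrite /degree (bigD1 m) //= ltn_addr //.
by rewrite lt0n.
Qed.

Let exponent i j := (degree a b j + \sum_k (i k == j))%N.

Lemma jacobian_mul_vars i :
  jacobian i * \prod_j 'X_j
    = \det (incidence_mx a b R i) *: \prod_j 'X_j ^+ exponent i j.
Proof.
(* The factors pulled out of the rows: since xi_j times the j-th derivative of a monomial is its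
   exponent times the monomial, row m yields Q_m, and the k-th unit row yields its own variable. *)
pose scal : 'rV[{mpoly R[n + p]}]_(n + p) :=
  row_mx (\row_m ('X_(a m) * 'X_(b m))) (\row_k 'X_(i k)).
pose X : 'rV[{mpoly R[n + p]}]_(n + p) := \row_j 'X_j.
have detX : \det (diag_mx X) = \prod_j 'X_j.
  by rewrite det_diag; apply: eq_bigr => j _; rewrite mxE.
have det_scal : \det (diag_mx scal) = \prod_j 'X_j ^+ exponent i j.
  rewrite det_diag big_split_ord /=.
  under eq_bigr => m _ do rewrite row_mxEl mxE.
  under [X in _ * X]eq_bigr => k _ do rewrite row_mxEr mxE.
  rewrite big_split /= !(prod_expr_fiber _ (fun j => 'X_j)).
  rewrite -!big_split /=; apply: eq_bigr => j _.
  by rewrite -!exprD /exponent /degree big_split.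
rewrite -det_scal -detX -mul_mpolyC -det_map_mx [RHS]mulrC -!det_mulmx.
rewrite mul_mx_diag mul_diag_mx; congr (\det _).
apply/matrixP=> r j; rewrite !mxE; case: split_ordP => [m | k] _; rewrite !mxE.
  rewrite /monomial_tuple mderivM !mderiv_var rmorph_nat natrD mulrDl mulrDr.
  congr (_ + _); case: eqP => [<- | _]; rewrite ?(mul0r, mulr0) //.
    by rewrite mul1r mulr1 mulrC.
  by rewrite !mulr1.
rewrite eqxx rmorph_nat eq_sym /=; case: eqP => [<- | _]; last by rewrite mul0r mulr0.
by rewrite mul1r mulr1.
Qed.

Hypothesis Q_vars : all_vars_occur (monomial_tuple R lam).

(** The product of the variables cancels in an integral domain. The predecessor never truncates, as
    each variable occurs and so has positive degree. *)
Lemma jacobianE i :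
  jacobian i
    = \det (incidence_mx a b R i) *: \prod_j 'X_j ^+ (exponent i j).-1.
Proof.
have vars_neq0 : \prod_(j < n + p) 'X_j != 0 :> {mpoly R[n + p]}.
  by apply/prodf_neq0 => j _; rewrite -msupp_eq0 msuppX.
apply: (mulIf vars_neq0); rewrite jacobian_mul_vars -scalerAl -big_split /=.
congr (_ *: _); apply: eq_bigr => j _; rewrite -exprSr prednK //.
by rewrite /exponent ltn_addr // degree_gt0.
Qed.

Lemma jacobian_neq0 i : (jacobian i != 0) = (\det (incidence_mx a b R i) != 0).
Proof.
rewrite jacobianE -mul_mpolyC mulf_eq0 mpolyC_eq0 negb_or andb_idr // => _.
by apply/prodf_neq0 => j _; rewrite expf_neq0 // -msupp_eq0 msuppX.
Qed.

(** The degrees add up to 2n, the unit rows contribute p, and one is subtracted in each of the n + p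
    columns. *)
Lemma sum_exponent i : (\sum_j (exponent i j).-1 = n)%N.
Proof.
have sum_deg : (\sum_j degree a b j = n + n)%N.
  rewrite (eq_bigl (fun j => j \in [set: 'I_(n + p)])) => [|j]; last by rewrite inE.
  rewrite sum_degree; under eq_bigr => m _ do rewrite !inE.
  by rewrite sum_nat_const card_ord muln2 addnn.
have sum_unit : (\sum_j \sum_k (i k == j) = p)%N.
  rewrite exchange_big -[RHS]card_ord -sum1_card; apply: eq_bigr => k _.
  rewrite (bigD1 (i k)) //= eqxx big1 // => j /negPf.
  by rewrite eq_sym => ->.
have expK j : ((exponent i j).-1 + 1 = exponent i j)%N.
  by rewrite addn1 prednK // /exponent ltn_addr // degree_gt0.
have : (\sum_j (exponent i j).-1 + \sum_(j < n + p) 1 = n + (n + p))%N.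
  rewrite -big_split /=; under eq_bigr => j _ do rewrite expK.
  by rewrite /exponent big_split /= sum_deg sum_unit addnA.
by rewrite sum1_card card_ord => /addIn.
Qed.

Lemma jacobian_main i (W := (\max_j multiplicity lam j)%N) :
    (1 <= n)%N -> jacobian i != 0 ->
  exists (c : R) (s : 'I_(n + p) -> nat),
    [/\ c != 0, jacobian i = c *: \prod_j 'X_j ^+ s j, (\sum_j s j = n)%N,
        (\max_j s j <= W)%N
      & W <> 1%N ->
        exists (i' : 'I_p -> 'I_(n + p)) (c' : R) (s' : 'I_(n + p) -> nat),
          [/\ c' != 0, jacobian i' = c' *: \prod_j 'X_j ^+ s' j,
              jacobian i' != 0, (\sum_j s' j = n)%N
            & (\max_j s' j <= W - 1)%N]].
Proof.
move=> n_ge1; rewrite jacobian_neq0 => det_i.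
have leW j : (degree a b j <= W)%N by rewrite -multiplicityE; apply: leq_bigmax.
have unit_row_le1 i' j : \det (incidence_mx a b R i') != 0 ->
    (\sum_k (i' k == j) <= 1)%N.
  move=> /incidence_mx_inj inj_i'.
  have [/existsP[k /eqP <-] | /existsPn no_k] := boolP [exists k, i' k == j].
    rewrite (bigD1 k) //= eqxx big1 // => l neq_lk.
    by rewrite (inj_eq inj_i') (negPf neq_lk).
  by rewrite big1 // => k _; rewrite (negPf (no_k k)).
exists (\det (incidence_mx a b R i)), (fun j => (exponent i j).-1).
split=> //; rewrite ?jacobianE ?sum_exponent //.
  apply/bigmax_leqP=> j _; rewrite -subn1 leq_subLR addnC.
  by rewrite leq_add ?unit_row_le1.
(* [W] is positive because n >= 1 provides an edge, whose end has positive degree. *)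
move=> W_neq1; have W_gt1 : (1 < W)%N.
  rewrite ltn_neqAle eq_sym; apply/andP; split; first exact/eqP.
  by apply: leq_trans (leW (a (Ordinal n_ge1))); apply: degree_gt0.
have [i' det_i' off_max] := unit_rows_off_max_degree W_gt1 leW det_i.
exists i', (\det (incidence_mx a b R i')), (fun j => (exponent i' j).-1).
split; rewrite ?jacobian_neq0 ?jacobianE ?sum_exponent //.
apply/bigmax_leqP=> j _; rewrite -subn1; apply: leq_sub2r.
(* A vertex carrying a unit row has degree at most W - 1 and carries only one; any other vertex has
   degree at most W. Either way the exponent before subtracting one is at most W. *)
have [/existsP[k /eqP def_j] | /existsPn no_k] := boolP [exists k, i' k == j].
  apply: leq_trans (leq_add (leqnn _) (unit_row_le1 _ j det_i')) _.
  by rewrite addn1 -def_j off_max.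
by rewrite /exponent big1 ?addn0 // => k _; rewrite (negPf (no_k k)).
Qed.

End Jacobian.

Theorem theorem2p1 (R : realType) (n d : nat) (n_ge1 : (1 <= n)%N)
    (le_nd : (n <= d)%N) (lam : 'I_(2 * n) -> 'I_d)
    (Q_vars : all_vars_occur (monomial_tuple R lam))
    (i : 'I_(d - n) -> 'I_d)
    (J_neq0 : gen_jacobian le_nd (monomial_tuple R lam) i != 0) :
  exists (c : R) (s : 'I_d -> nat),
    [/\ c != 0,
        gen_jacobian le_nd (monomial_tuple R lam) i
          = c *: \prod_(j < d) 'X_j ^+ s j,
        (\sum_(j < d) s j = n)%N,
        (\max_(j < d) s j <= \max_(j < d) multiplicity lam j)%N
      & (\max_(j < d) multiplicity lam j)%N <> 1%N ->
        exists (i' : 'I_(d - n) -> 'I_d) (c' : R) (s' : 'I_d -> nat),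
          [/\ c' != 0,
              gen_jacobian le_nd (monomial_tuple R lam) i'
                = c' *: \prod_(j < d) 'X_j ^+ s' j,
              gen_jacobian le_nd (monomial_tuple R lam) i' != 0,
              (\sum_(j < d) s' j = n)%N
            & (\max_(j < d) s' j <= \max_(j < d) multiplicity lam j - 1)%N]].
Proof.
move: i J_neq0; rewrite /gen_jacobian.
(* With d - n generalized to [p], eliminating the equation n + p = d turns the cast into the
   identity. *)
move: (subnKC le_nd); move: (d - n)%N => p e.
case: d / e lam Q_vars {le_nd} => lam Q_vars i.
exact: jacobian_main.
Qed.
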